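(* Let $\Omega\in\mathcal B(\mathbb R^n)$, let $C\subset\overline\Omega$ be nonempty and closed in $\mathbb R^n$ with $\mathcal L^n(C\cap\Omega)=0$, and let $\mu\in\mathrm{Dens}_C$. Then $\mu$ is an extreme point of $\mathrm{Dens}_C$ if and only if $\mu$ is a $0$-$1$ measure.
   Context: $\mathcal L^n$ is Lebesgue measure on $\mathbb R^n$, $\mathcal B(\Omega)$ the Borel subsets of $\Omega$. A measure on $\Omega$ means a finitely additive set function on $\mathcal B(\Omega)$ vanishing at $\emptyset$. $\mathrm{ba}(\Omega,\mathcal B(\Omega),\mathcal L^n)$ is the space of bounded real-valued finitely additive measures $\mu$ on $\mathcal B(\Omega)$ such that $\mu(A)=0$ whenever $\mathcal L^n(A)=0$. $C_\delta$ denotes the open $\delta$-neighborhood of $C$ in $\mathbb R^n$. $\mathrm{Dens}_C$ is the set of density measures at $C$ on $\Omega$, i.e. of all $\mu\in\mathrm{ba}(\Omega,\mathcal B(\Omega),\mathcal L^n)$ with $\mu\ge 0$ and $\mu(C_\delta\cap\Omega)=\mu(\Omega)=1$ for all $\delta>0$. A nontrivial $\mu\in\mathrm{ba}(\Omega,\mathcal B(\Omega),\mathcal L^n)$ is a $0$-$1$ measure if $\mu(B)\in\{0,1\}$ for every $B\in\mathcal B(\Omega)$. A point $u$ of a set $M$ in a linear space is an extreme point of $M$ if for all $u_1,u_2\in M$ with $u_1\neq u_2$ and all $\alpha\in[0,1]$, $u=\alpha u_1+(1-\alpha)u_2$ implies $\alpha\in\{0,1\}$. *)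

(* Defs.v *)
From mathcomp Require Import all_boot all_order all_algebra.
From mathcomp Require Import all_classical all_reals all_analysis.

Set Implicit Arguments.
Unset Strict Implicit.
Unset Printing Implicit Defensive.

Import Order.TTheory GRing.Theory Num.Theory.
Import numFieldNormedType.Exports.

Local Open Scope classical_set_scope.
Local Open Scope ring_scope.

Section euclidean_space.
Context {R : realType} {n : nat}.
Implicit Types (x a b : 'rV[R]_n) (A Omega C : set 'rV[R]_n).

(* The topology of ['rV[R]_n] is the product topology. *)
Definition borel : set (set 'rV[R]_n) := <<s @open 'rV[R]_n >>.

(* For a Borel set [Omega] these are the Borel sets of the subspace [Omega]. *)
Definition borel_in Omega : set (set 'rV[R]_n) :=
  [set A | borel A /\ A `<=` Omega].

(* The library norm of ['rV[R]_n] is the maximum norm. *)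
Definition enorm x : R := Num.sqrt (\sum_i x 0 i ^+ 2).

Definition open_neighborhood C (delta : R) : set 'rV[R]_n :=
  [set x | exists2 y, C y & enorm (x - y) < delta].

Definition box a b : set 'rV[R]_n := [set x | forall i, a 0 i <= x 0 i < b 0 i].

Definition box_volume a b : R := \prod_i Num.max 0 (b 0 i - a 0 i).

(* The Lebesgue outer measure. The covers are families of boxes indexed by an
   arbitrary set [D] of naturals, so that finite and empty covers are allowed;
   in dimension 0, where no box is empty, the empty set needs an empty cover. *)
Definition lebesgue A : \bar R := ereal_inf
  [set v | exists D : set nat, exists a b : nat -> 'rV[R]_n,
    A `<=` \bigcup_(k in D) box (a k) (b k) /\
    v = (\esum_(k in D) (box_volume (a k) (b k))%:E)%E].

End euclidean_space.

Definition extreme_point {R : realType} {V : lmodType R} (M : set V) (u : V) :=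
  M u /\
  forall u1 u2 : V, M u1 -> M u2 -> u1 <> u2 ->
  forall alpha : R, 0 <= alpha <= 1 ->
  u = alpha *: u1 + (1 - alpha) *: u2 -> alpha = 0 \/ alpha = 1.

Section density_measures.
Context {R : realType} {n : nat}.
Implicit Types (Omega C : set 'rV[R]_n).

(* Real-valued set functions on ['rV[R]_n], as a vector space with pointwise
   operations. *)
Definition set_function : lmodType R := set 'rV[R]_n -> R^o.

(* A set function on [borel_in Omega] is represented by its extension by 0 to
   all subsets of R^n. The extension is unique, so that equality in [set_function]
   is equality on [borel_in Omega]. *)
Record ba Omega (mu : set_function) : Prop := Ba {
  ba_outside : forall A, ~ borel_in Omega A -> mu A = 0;
  ba_set0 : mu set0 = 0;
  ba_additive : forall A B, borel_in Omega A -> borel_in Omega B ->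
    A `&` B = set0 -> mu (A `|` B) = mu A + mu B;
  ba_bounded : exists K : R, forall A, borel_in Omega A -> `|mu A| <= K;
  ba_null : forall A, borel_in Omega A -> lebesgue A = 0%E -> mu A = 0
}.

Record Dens Omega C (mu : set_function) : Prop := DensMeasure {
  Dens_ba : ba Omega mu;
  Dens_ge0 : forall A, borel_in Omega A -> 0 <= mu A;
  Dens_near : forall delta : R, 0 < delta ->
    mu (open_neighborhood C delta `&` Omega) = 1;
  Dens_total : mu Omega = 1
}.

Record zero_one_measure Omega (mu : set_function) : Prop := ZeroOneMeasure {
  zero_one_ba : ba Omega mu;
  zero_one_neq0 : mu <> 0;
  zero_one_val : forall B, borel_in Omega B -> mu B = 0 \/ mu B = 1
}.

End density_measures.

Arguments set_function : clear implicits.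

(* Main.v *)
Require Import Defs.
From mathcomp Require Import all_boot all_order all_algebra.
From mathcomp Require Import all_classical all_reals all_analysis.
From mathcomp Require Import lra.
Import Order.TTheory GRing.Theory Num.Theory.
Import numFieldNormedType.Exports.
Local Open Scope classical_set_scope.
Local Open Scope ring_scope.

Set Implicit Arguments.
Unset Strict Implicit.

(** A density measure takes its values in [0, 1], so the values 0 and 1 are
extreme among the possible ones: if [mu] only takes these two values and is a
proper convex combination of two density measures, then both of them agree with
[mu] on every Borel set, hence with each other.

Conversely, if [0 < mu B < 1] for some [B], then [mu] is split by conditioning:
it is the combination, with weights [mu B] and [1 - mu B], of its normalized
restrictions to [B] and to [Omega `\` B] ([conditional_split]).  These two
differ on [B].  The point is that they are again density measures at [C]
([Dens_conditional]): the part of [Omega] outside of a neighborhood of [C] has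
no mass, hence neither has the part of [B] outside of it, and subsets of null
sets are null. *)

Section borel_subsets.
Context {R : realType} {n : nat}.
Implicit Types Omega A B : set 'rV[R]_n.

Lemma borel_inI Omega A B :
  borel_in Omega A -> borel_in Omega B -> borel_in Omega (A `&` B).
Proof.
move=> [mA sA] [mB _]; split; last by move=> x [/sA].
exact: (@measurableI _ (g_sigma_algebraType (@open 'rV[R]_n))).
Qed.

Lemma borel_inD Omega A B :
  borel_in Omega A -> borel_in Omega B -> borel_in Omega (A `\` B).
Proof.
move=> [mA sA] [mB _]; split; last by move=> x [/sA].
exact: (@measurableD _ (g_sigma_algebraType (@open 'rV[R]_n))).
Qed.

Lemma borel_inU Omega A B :
  borel_in Omega A -> borel_in Omega B -> borel_in Omega (A `|` B).
Proof.
move=> [mA sA] [mB sB]; split; last by move=> x [/sA|/sB].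
exact: (@measurableU _ (g_sigma_algebraType (@open 'rV[R]_n))).
Qed.

Lemma lebesgue_ge0 A : (0 <= lebesgue A)%E.
Proof.
apply: le_ereal_inf_tmp => _ [D [a [b [_ ->]]]].
apply: esum_ge0 => k _; rewrite lee_fin; apply: prodr_ge0 => i _.
by rewrite le_max lexx.
Qed.

Lemma lebesgue_subset A B : A `<=` B -> (lebesgue A <= lebesgue B)%E.
Proof.
move=> AB; apply: ereal_inf_le_tmp => v [D [a [b [Bab ->]]]].
by exists D, a, b; split=> //; exact: subset_trans Bab.
Qed.

Lemma lebesgue_null_subset A B : A `<=` B -> lebesgue B = 0%E -> lebesgue A = 0%E.
Proof.
move=> AB B0; apply/eqP; rewrite eq_le lebesgue_ge0 andbT -B0.
exact: lebesgue_subset.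
Qed.

End borel_subsets.

Section density_measure_theory.
Context {R : realType} {n : nat}.
Implicit Types (Omega C A B : set 'rV[R]_n) (mu : set_function R n).

Lemma ba_split Omega mu A B : ba Omega mu ->
  borel_in Omega A -> borel_in Omega B ->
  mu A = mu (A `&` B) + mu (A `\` B).
Proof.
move=> hmu hA hB; rewrite -(ba_additive hmu).
- by rewrite setUIDK.
- exact: borel_inI.
- exact: borel_inD.
- by rewrite setDE setIACA setICr setI0.
Qed.

(** Members of [ba Omega] vanish outside of [borel_in Omega]: a set of nonzero
measure is Borel.  This gives the measurability of [Omega] and of the
neighborhoods of [C] from their mass alone. *)
Lemma ba_neq0_borel Omega mu A : ba Omega mu -> mu A <> 0 -> borel_in Omega A.
Proof. by move=> hmu muA; apply: contrapT => /(ba_outside hmu). Qed.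

Lemma Dens_borel_total Omega C mu : Dens Omega C mu -> borel_in Omega Omega.
Proof.
move=> hmu; apply: (ba_neq0_borel (Dens_ba hmu)).
by rewrite (Dens_total hmu); apply/eqP; rewrite oner_eq0.
Qed.

Lemma Dens_borel_near Omega C mu delta : Dens Omega C mu -> 0 < delta ->
  borel_in Omega (open_neighborhood C delta `&` Omega).
Proof.
move=> hmu d0; apply: (ba_neq0_borel (Dens_ba hmu)).
by rewrite (Dens_near hmu d0); apply/eqP; rewrite oner_eq0.
Qed.

Lemma Dens_mono Omega C mu A B : Dens Omega C mu ->
  borel_in Omega A -> borel_in Omega B -> A `<=` B -> mu A <= mu B.
Proof.
move=> hmu hA hB AB.
rewrite (ba_split (Dens_ba hmu) hB hA) (setIidr AB) lerDl.
exact/(Dens_ge0 hmu)/borel_inD.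
Qed.

Lemma Dens_le1 Omega C mu A : Dens Omega C mu -> borel_in Omega A -> mu A <= 1.
Proof.
move=> hmu hA; rewrite -(Dens_total hmu).
apply: (Dens_mono hmu hA (Dens_borel_total hmu)).
by case: hA.
Qed.

Lemma Dens_setC Omega C mu B : Dens Omega C mu -> borel_in Omega B ->
  mu (Omega `\` B) = 1 - mu B.
Proof.
move=> hmu hB; rewrite -(Dens_total hmu).
rewrite (ba_split (Dens_ba hmu) (Dens_borel_total hmu) hB).
by rewrite (setIidr hB.2) addrC addKr.
Qed.

(** A set of full measure can be intersected away, as its complement carries
no mass. *)
Lemma Dens_full_setI Omega C mu A B : Dens Omega C mu ->
  borel_in Omega A -> borel_in Omega B -> mu A = 1 -> mu (A `&` B) = mu B.
Proof.
move=> hmu hA hB A1.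
rewrite [RHS](ba_split (Dens_ba hmu) hB hA) setIC.
suff -> : mu (B `\` A) = 0 by rewrite addr0.
have hBA := borel_inD hB hA.
have hT := Dens_borel_total hmu.
apply/eqP; rewrite eq_le (Dens_ge0 hmu hBA) andbT.
rewrite -(subrr 1) -[X in 1 - X]A1 -(Dens_setC hmu hA).
apply: (Dens_mono hmu hBA (borel_inD hT hA)).
by apply: setSD; case: hB.
Qed.

(** The case distinction restores the extension by 0: [A `&` B] may be Borel
when [A] is not. *)
Definition conditional Omega mu B : set_function R n :=
  fun A => if `[< borel_in Omega A >] then mu (A `&` B) / mu B else 0.

Lemma conditionalE Omega mu B A : borel_in Omega A ->
  conditional Omega mu B A = mu (A `&` B) / mu B.
Proof. by move=> hA; rewrite /conditional asboolT. Qed.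

Lemma conditional_outside Omega mu B A : ~ borel_in Omega A ->
  conditional Omega mu B A = 0.
Proof. by move=> hA; rewrite /conditional asboolF. Qed.

Lemma ba_conditional Omega mu B : ba Omega mu -> borel_in Omega B ->
  ba Omega (conditional Omega mu B).
Proof.
move=> hmu hB; split.
- by move=> A; exact: conditional_outside.
- rewrite /conditional set0I (ba_set0 hmu) mul0r.
  by case: ifP.
- move=> A A' hA hA' AA'; rewrite !conditionalE //; last exact: borel_inU.
  rewrite setIUl (ba_additive hmu) ?mulrDl //; try exact: borel_inI.
  by rewrite setIACA AA' set0I.
- have [K hK] := ba_bounded hmu; exists (K / `|mu B|) => A hA.
  rewrite conditionalE // normrM normfV ler_wpM2r ?invr_ge0 //.
  exact/hK/borel_inI.
- move=> A hA A0; rewrite conditionalE // (ba_null hmu) ?mul0r //.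
    exact: borel_inI.
  exact: (lebesgue_null_subset (@subIsetl _ A B) A0).
Qed.

(** Every set of full [mu]-measure keeps full measure after conditioning; in
particular the neighborhoods of [C] do. *)
Lemma Dens_conditional Omega C mu B : Dens Omega C mu -> borel_in Omega B ->
  0 < mu B -> Dens Omega C (conditional Omega mu B).
Proof.
move=> hmu hB B0.
have full A : borel_in Omega A -> mu A = 1 -> conditional Omega mu B A = 1.
  move=> hA A1; rewrite conditionalE // (Dens_full_setI hmu) //.
  by rewrite divff // gt_eqF.
split.
- by apply: ba_conditional => //; exact: Dens_ba hmu.
- move=> A hA; rewrite conditionalE // divr_ge0 //; last exact: ltW.
  exact/(Dens_ge0 hmu)/borel_inI.
- move=> delta d0; apply: full; last exact: (Dens_near hmu).
  exact: Dens_borel_near hmu d0.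
- by apply: full; [exact: Dens_borel_total hmu|exact: Dens_total hmu].
Qed.

(** The law of total probability: the weights cancel the normalizations, since
[Omega `\` B] has mass [1 - mu B]. *)
Lemma conditional_split Omega C mu B : Dens Omega C mu -> borel_in Omega B ->
  0 < mu B < 1 ->
  mu = mu B *: conditional Omega mu B +
       (1 - mu B) *: conditional Omega mu (Omega `\` B).
Proof.
move=> hmu hB /andP[B0 B1]; apply/funext => A.
rewrite -[RHS]/(mu B * conditional Omega mu B A +
                (1 - mu B) * conditional Omega mu (Omega `\` B) A).
have [hA|hA] := pselect (borel_in Omega A); last first.
  by rewrite !conditional_outside // (ba_outside (Dens_ba hmu) hA) !mulr0 addr0.
rewrite !conditionalE // (Dens_setC hmu) //.
rewrite ![_ * (_ / _)]mulrC !divfK ?subr_eq0; [|by rewrite gt_eqF..].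
by rewrite setIDA (setIidl hA.2); exact: (ba_split (Dens_ba hmu)).
Qed.

Lemma extreme_zero_one Omega C mu :
  extreme_point [set nu : set_function R n | Dens Omega C nu] mu ->
  zero_one_measure Omega mu.
Proof.
move=> [/= hmu ext]; split; first exact: Dens_ba hmu.
  move=> mu0; have := Dens_total hmu; rewrite mu0 => /eqP.
  by rewrite -[_ Omega]/(0 : R) eq_sym oner_eq0.
move=> B hB; apply: contrapT => /not_orP[/eqP B0 /eqP B1].
have {}B0 : 0 < mu B by rewrite lt_neqAle eq_sym B0 (Dens_ge0 hmu hB).
have {}B1 : mu B < 1 by rewrite lt_neqAle B1 (Dens_le1 hmu hB).
have hB' := borel_inD (Dens_borel_total hmu) hB.
have B'0 : 0 < mu (Omega `\` B) by rewrite (Dens_setC hmu hB) subr_gt0.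
have neq : conditional Omega mu B <> conditional Omega mu (Omega `\` B).
  move=> /(congr1 (fun f : set_function R n => f B)).
  rewrite !conditionalE // setIid divff ?gt_eqF //.
  have -> : B `&` (Omega `\` B) = set0 by rewrite -subset0 => x [? []].
  rewrite (ba_set0 (Dens_ba hmu)) mul0r => /eqP.
  by rewrite oner_eq0.
have B01 : 0 <= mu B <= 1 by rewrite !ltW.
have B01' : 0 < mu B < 1 by rewrite B0.
have := ext _ _ (Dens_conditional hmu hB B0)
  (Dens_conditional hmu hB' B'0) neq (mu B) B01
  (conditional_split hmu hB B01').
by case=> muB; move: B0 B1; rewrite muB ltxx.
Qed.

Lemma zero_one_extreme Omega C mu : Dens Omega C mu ->
  zero_one_measure Omega mu ->
  extreme_point [set nu : set_function R n | Dens Omega C nu] mu.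
Proof.
move=> hmu [_ _ val01]; split=> // u1 u2 /= hu1 hu2 neq alpha /andP[a0 a1] eqmu.
apply: contrapT => /not_orP[/eqP an0 /eqP an1]; apply: neq.
have {}a0 : 0 < alpha by rewrite lt_neqAle eq_sym an0.
have {}a1 : alpha < 1 by rewrite lt_neqAle an1.
apply/funext => A; have [hA|hA] := pselect (borel_in Omega A); last first.
  by rewrite (ba_outside (Dens_ba hu1) hA) (ba_outside (Dens_ba hu2) hA).
have muA : mu A = alpha * u1 A + (1 - alpha) * u2 A by rewrite {1}eqmu.
have u1A0 : 0 <= u1 A := Dens_ge0 hu1 hA.
have u2A0 : 0 <= u2 A := Dens_ge0 hu2 hA.
have u1A1 : u1 A <= 1 := Dens_le1 hu1 hA.
have u2A1 : u2 A <= 1 := Dens_le1 hu2 hA.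
(* With positive weights, a mean of two numbers of [0, 1] is an endpoint only
   if both numbers are this endpoint. *)
case: (val01 _ hA) => muA01; rewrite muA01 in muA.
- have -> : u1 A = 0 by nra.
  by have -> : u2 A = 0 by nra.
- have -> : u1 A = 1 by nra.
  by have -> : u2 A = 1 by nra.
Qed.

End density_measure_theory.

Theorem theorem4p2 (R : realType) (n : nat) (Omega C : set 'rV[R]_n)
    (hOmega : borel Omega)
    (hCOmega : C `<=` closure Omega)
    (hC0 : C !=set0)
    (hCclosed : closed C)
    (hCnull : lebesgue (C `&` Omega) = 0%E)
    (mu : set_function R n)
    (hmu : Dens Omega C mu) :
  extreme_point [set nu : set_function R n | Dens Omega C nu] mu
  <-> zero_one_measure Omega mu.
Proof.
by split; [exact: extreme_zero_one|exact: zero_one_extreme].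
Qed.
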